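(* Let $\mathcal{X}$ be a (real or complex) Banach space with $\dim \mathcal{X}\geq 2$, let $\mathcal{N}$ be a nest on $\mathcal{X}$ such that each $N\in\mathcal{N}$ with $N_{-}=N$ is complemented in $\mathcal{X}$, and let $\delta: Alg\mathcal{N}\rightarrow Alg\mathcal{N}$ be a linear map. Then $\delta$ is a local derivation if and only if $\delta$ is a derivation.
   Context: A nest $\mathcal{N}$ on a Banach space $\mathcal{X}$ is a chain (under inclusion) of norm-closed subspaces of $\mathcal{X}$ containing $\{0\}$ and $\mathcal{X}$ such that for every family $\{N_i\}$ of elements of $\mathcal{N}$, both $\bigcap N_i$ and $\bigvee N_i$ (the closed linear span of the $N_i$) belong to $\mathcal{N}$. The nest algebra $Alg\mathcal{N}$ is the algebra of all bounded linear operators on $\mathcal{X}$ that leave every member of $\mathcal{N}$ invariant. For $N\in\mathcal{N}$, $N_{-}:=\bigvee\{M\in\mathcal{N} : M\subsetneq N\}$. For an algebra $\mathcal{A}$, a derivation is a linear map $d:\mathcal{A}\to\mathcal{A}$ with $d(ab)=d(a)b+ad(b)$ for all $a,b\in\mathcal{A}$. A linear map $\delta:\mathcal{A}\to\mathcal{A}$ is a local derivation if for each $a\in\mathcal{A}$ there is a derivation $\delta_a:\mathcal{A}\to\mathcal{A}$, depending on $a$, with $\delta(a)=\delta_a(a)$. Linear maps are linear over the scalar field of $\mathcal{X}$ and are not assumed continuous. *)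

(* Defs.v *)
From HB Require Import structures.
From mathcomp Require Import all_boot all_order all_algebra.
From mathcomp Require Import all_classical all_reals all_analysis.
From mathcomp Require Import complex.

Set Implicit Arguments.
Unset Strict Implicit.
Unset Printing Implicit Defensive.

Import Order.TTheory GRing.Theory Num.Theory.
Import numFieldNormedType.Exports.

Local Open Scope classical_set_scope.
Local Open Scope ring_scope.

Variant real_or_complex : numFieldType -> Prop :=
| RealScalars (R : realType) : real_or_complex R
| ComplexScalars (R : realType) : real_or_complex (complex R).

Section NormedSpace.
Variables (K : numFieldType) (X : normedModType K).
Implicit Types (A M N S : set X) (F Nst : set (set X)) (T : X -> X).

(* At least [n], possibly infinite: [\dim] is only available for [vectType]. *)
Definition dim_ge (n : nat) : Prop :=
  exists v : 'I_n -> X,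
    forall c : 'I_n -> K, \sum_i c i *: v i = 0 -> forall i, c i = 0.

Definition is_subspace A : Prop := submod_closed [in A].

Definition closed_subspace A : Prop := is_subspace A /\ closed A.

Definition lin_span S : set X := smallest is_subspace S.

Definition closed_span S : set X := closure (lin_span S).

(* Empty families are allowed in the last two clauses: their intersection is
   [setT] and their closed span is [[set 0]], which belong to [Nst] anyway. *)
Definition is_nest Nst : Prop :=
  [/\ forall N, Nst N -> closed_subspace N,
      total_on Nst subset,
      Nst [set 0] /\ Nst setT,
      forall F, F `<=` Nst -> Nst (\bigcap_(N in F) N)
    & forall F, F `<=` Nst -> Nst (closed_span (\bigcup_(N in F) N))].

Record nest := Nest { nest_set :> set (set X); nestP : is_nest nest_set }.

(* The subspace $N_-$. *)
Definition nest_pred (Nst : nest) N : set X :=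
  closed_span (\bigcup_(M in [set M | nest_set Nst M /\ M `<` N]) M).

(* Topologically complemented: the complement is required to be closed. *)
Definition complemented N : Prop :=
  exists M, [/\ closed_subspace M, N `&` M = [set 0]
    & forall x, exists y z, [/\ N y, M z & x = y + z]].

Definition bounded_operator T : Prop :=
  linear T /\ exists C : K, forall x, `|T x| <= C * `|x|.

Definition leaves_invariant T N : Prop := forall x, N x -> N (T x).

Definition nest_operator (Nst : nest) : {pred X -> X} :=
  mem [set T | bounded_operator T /\
               forall N, nest_set Nst N -> leaves_invariant T N].

Record nest_algebra (Nst : nest) := NestAlgebra {
  nest_algebra_val :> X -> X;
  _ : nest_algebra_val \in nest_operator Nst }.

Lemma nest_operatorP (Nst : nest) T :
  reflect (bounded_operator T /\
           forall N, nest_set Nst N -> leaves_invariant T N)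
          (T \in nest_operator Nst).
Proof. exact: asboolP. Qed.

Lemma nest_operator_submod (Nst : nest) : submod_closed (nest_operator Nst).
Proof.
have subN N : nest_set Nst N -> is_subspace N.
  by move=> NN; case: (nestP Nst) => /(_ _ NN)[].
split.
  have E x : (0 : X -> X) x = 0 by [].
  apply/nest_operatorP; split.
    split; first by move=> a x y; rewrite !E scaler0 addr0.
    by exists 0 => x; rewrite mul0r E normr0.
  by move=> N /subN[+ _] x Nx; rewrite inE E.
move=> k f g /nest_operatorP[[lf [C Cf]] fN] /nest_operatorP[[lg [D Dg]] gN].
have E x : (k *: f + g) x = k *: f x + g x by [].
apply/nest_operatorP; split.
  split.
    move=> a x y; rewrite !E lf lg !scalerDr !scalerA (mulrC k a).
    by rewrite -!addrA; congr (_ + _); rewrite addrCA.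
  exists (`|k| * C + D) => x; rewrite E (le_trans (ler_normD _ _))//.
  by rewrite mulrDl lerD// normrZ -mulrA ler_wpM2l.
move=> N NN x Nx; case: (subN _ NN) => _ /(_ k (f x) (g x)).
by rewrite !inE E; apply; [exact: fN|exact: gN].
Qed.

Lemma nest_operator_id (Nst : nest) : id \in nest_operator Nst.
Proof.
apply/nest_operatorP; split; last by move=> N _ x.
by split; [move=> a x y|exists 1 => x; rewrite mul1r].
Qed.

Lemma nest_operator_comp (Nst : nest) (f g : nest_algebra Nst) :
  f \o g \in nest_operator Nst.
Proof.
case: f g => f /= /nest_operatorP[[lf [C Cf]] fN].
case=> g /= /nest_operatorP[[lg [D Dg]] gN].
apply/nest_operatorP; split; last first.
  by move=> N NN x Nx; apply: fN => //; exact: gN.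
split; first by move=> a x y /=; rewrite lg lf.
exists (`|C| * D) => x /=; rewrite -mulrA.
have h : 0 <= C * `|g x| by rewrite (le_trans _ (Cf _)).
by rewrite (le_trans (Cf _))// -(ger0_norm h) normrM normr_id ler_wpM2l.
Qed.

End NormedSpace.

Section NestAlgebraStructure.
Variables (K : numFieldType) (X : normedModType K) (Nst : nest X).
Local Notation Alg := (nest_algebra Nst).

HB.instance Definition _ := [isSub for @nest_algebra_val K X Nst].
HB.instance Definition _ := [Choice of Alg by <:].
HB.instance Definition _ :=
  GRing.isSubmodClosed.Build K (X -> X) (nest_operator Nst)
    (nest_operator_submod Nst).
HB.instance Definition _ := [SubChoice_isSubLmodule of Alg by <:].

(* The product is composition, not the pointwise product of functions. *)
Let one : Alg := NestAlgebra (nest_operator_id Nst).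
Let mul (a b : Alg) : Alg := NestAlgebra (nest_operator_comp a b).

Let mulA : associative mul.
Proof. by move=> a b c; exact: val_inj. Qed.
Let mul1 : left_id one mul.
Proof. by move=> a; exact: val_inj. Qed.
Let mulr1 : right_id one mul.
Proof. by move=> a; exact: val_inj. Qed.
Let mulDl : left_distributive mul +%R.
Proof. by move=> a b c; exact: val_inj. Qed.
Let mulDr : right_distributive mul +%R.
Proof.
move=> a b c; apply: val_inj; apply/funext => x /=.
have /nest_operatorP[[la _] _] := valP a.
by have := la 1 (b x) (c x); rewrite !scale1r.
Qed.

(* Not an [algType], whose unit must be nonzero: [X] may be trivial here. *)
HB.instance Definition _ :=
  GRing.Zmodule_isPzRing.Build Alg mulA mul1 mulr1 mulDl mulDr.

Lemma nest_algebra_mulE (a b : Alg) x : (a * b) x = a (b x).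
Proof. by []. Qed.

Lemma nest_algebra_scaleE k (a : Alg) x : (k *: a) x = k *: a x.
Proof. by []. Qed.

Lemma nest_algebra_addE (a b : Alg) x : (a + b) x = a x + b x.
Proof. by []. Qed.

Definition derivation (d : {linear Alg -> Alg}) : Prop :=
  forall a b, d (a * b) = d a * b + a * d b.

Definition local_derivation (delta : {linear Alg -> Alg}) : Prop :=
  forall a, exists2 d : {linear Alg -> Alg}, derivation d & delta a = d a.

End NestAlgebraStructure.

(* Main.v *)
Require Import Defs.
From HB Require Import structures.
From mathcomp Require Import all_boot all_order all_algebra.
From mathcomp Require Import ring lra.
From mathcomp Require Import all_classical all_reals all_analysis.
From mathcomp Require Import complex.

Set Implicit Arguments.
Unset Strict Implicit.
Unset Printing Implicit Defensive.

Import Order.TTheory GRing.Theory Num.Theory.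
Import numFieldNormedType.Exports.

Local Open Scope classical_set_scope.
Local Open Scope ring_scope.

(** A derivation is a local derivation, with itself as witness at every
    point. For the converse let [delta] be a local derivation.

    Algebra. Comparing [delta] at [b] with a derivation shows that
    [a * delta b * c = 0] whenever [a * b = 0] and [b * c = 0]. Cutting an
    element [x] by idempotents [p], [q] and their complements turns this into
    the two-sided Leibniz rule
    [delta (p x q) = delta (p x) q + p delta (x q) - p delta x q], and the set
    of pairs obeying this rule is stable under sums, products and scaling in
    each argument ([sandwich_generated]). So if an ideal [J] consists of
    elements generated by idempotents, then the Leibniz defect
    [D = delta (x y) - delta x y - x delta y] satisfies [a D b = 0] for all
    [a], [b] in [J] ([leibniz_defect_annihilated]).

    The ideal. Take for [J] the operators [y |-> f y *: x] of the nest
    algebra, with [x] in some member [N] of the nest and [f] a bounded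
    functional vanishing on the predecessor [N_-]. These dyads are generated
    by idempotents ([dyad_generated]). If [f] does not vanish on [N], the dyad
    is a combination of two idempotent dyads. If [f] vanishes on [N] but
    [N_-] is smaller than [N], a functional which is [1] at a point of
    [N \ N_-] and vanishes on [N_-] writes the dyad as a product of generated
    ones. If [N_- = N], the complement of [N] gives a bounded projection [P]
    onto [N]; as [P] fixes the range of the dyad [a] and [a] kills that of [P],
    both [P] and [P + a] are idempotents of the algebra.

    Faithfulness. If [a t b = 0] for all dyads [a], [b], then [t = 0]
    ([dyads_faithful]): every nonzero vector is detected by a dyad on the left
    because the intersection of the [M_-] over nonzero [M] is zero, and the
    members [N] with [N_-] proper span a dense subspace.

    The analytic input is the Hahn-Banach theorem and the boundedness of the
    projection given by a closed complement. Both are shown over the reals, by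
    Zorn's lemma and by Baire's theorem respectively, and carried over to
    complex spaces by restriction of scalars. *)

(** * Local derivations and idempotents *)

Section NestAlgebraLinear.
Variables (K : numFieldType) (X : normedModType K) (Nst : nest X).
Local Notation Alg := (nest_algebra Nst).

Fact nest_algebra_val_linear (a : Alg) : linear (nest_algebra_val a).
Proof. by have /nest_operatorP[[]] := valP a. Qed.

HB.instance Definition _ (a : Alg) :=
  GRing.isLinear.Build K X X _ (nest_algebra_val a) (nest_algebra_val_linear a).

Lemma nest_algebra_scaleAl k (a b : Alg) : (k *: a) * b = k *: (a * b).
Proof. exact: val_inj. Qed.

Lemma nest_algebra_scaleAr k (a b : Alg) : a * (k *: b) = k *: (a * b).
Proof. by apply: val_inj; apply/funext => z; exact: (linearZ_LR a). Qed.

End NestAlgebraLinear.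

Section LocalDerivations.
Context {K : numFieldType} {X : normedModType K} {Nst : nest X}.
Local Notation Alg := (nest_algebra Nst).
Implicit Types (a b c p q x y : Alg) (k : K).

Inductive idempotent_generated : Alg -> Prop :=
| IdemGenBase p : p * p = p -> idempotent_generated p
| IdemGenAdd a b : idempotent_generated a -> idempotent_generated b ->
    idempotent_generated (a + b)
| IdemGenMul a b : idempotent_generated a -> idempotent_generated b ->
    idempotent_generated (a * b)
| IdemGenScale k a : idempotent_generated a -> idempotent_generated (k *: a).

Lemma idempotent_generatedB a b : idempotent_generated a ->
  idempotent_generated b -> idempotent_generated (a - b).
Proof.
by move=> ga gb; rewrite -scaleN1r; apply: IdemGenAdd => //; exact: IdemGenScale.
Qed.

Variable delta : {linear Alg -> Alg}.

(** The Leibniz rule for products with an arbitrary middle factor; for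
    [delta] a derivation it follows by expanding [delta (a * x * b)] in two
    ways. It has the advantage of being stable under products in [a] and in
    [b] separately. *)
Definition sandwich_leibniz a b := forall x,
  delta (a * x * b) = delta (a * x) * b + a * delta (x * b) - a * delta x * b.

Section AnnihilatorPreserving.
Hypothesis delta_ann : forall a b c,
  a * b = 0 -> b * c = 0 -> a * delta b * c = 0.

(** Of the four corners of [delta (p x q)] with respect to [p] and [q], the one
    at [1 - p], [1 - q] vanishes; in the other three [p x q] may be replaced
    with [x q], [p x] and [p x + x q - x] respectively, since the error is a
    corner of [delta ((1 - p) x q)], [delta (p x (1 - q))] or
    [delta ((1 - p) x (1 - q))] that vanishes too. *)
Lemma sandwich_idempotent p q : p * p = p -> q * q = q -> sandwich_leibniz p q.
Proof.
move=> pp qq x.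
have p0 : p * (1 - p) = 0 by rewrite mulrBr mulr1 pp subrr.
have p1 : (1 - p) * p = 0 by rewrite mulrBl mul1r pp subrr.
have q0 : q * (1 - q) = 0 by rewrite mulrBr mulr1 qq subrr.
have q1 : (1 - q) * q = 0 by rewrite mulrBl mul1r qq subrr.
have ann r s u v : u * r = 0 -> s * v = 0 -> u * delta (r * x * s) * v = 0.
  move=> ur sv; apply: delta_ann; first by rewrite !mulrA ur !mul0r.
  by rewrite -!mulrA sv !mulr0.
set A := delta (p * x * q).
have e1 : (1 - p) * A * (1 - q) = 0 by exact: ann.
have e2 : p * A * (1 - q) = p * delta (x * q) * (1 - q).
  apply/eqP; rewrite eq_sym -subr_eq0 -mulrBl -mulrBr -raddfB.
  by rewrite -{1}[x]mul1r -!mulrBl; apply/eqP; exact: ann.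
have e3 : (1 - p) * A * q = (1 - p) * delta (p * x) * q.
  apply/eqP; rewrite eq_sym -subr_eq0 -mulrBl -mulrBr -raddfB.
  by rewrite -{1}[p * x]mulr1 -!mulrBr; apply/eqP; exact: ann.
have e4 : p * A * q = p * delta (p * x) * q + p * delta (x * q) * q -
    p * delta x * q.
  apply/eqP; rewrite eq_sym -subr_eq0 -mulrDl -mulrDr -!mulrBl -!mulrBr.
  have -> : delta (p * x) + delta (x * q) - delta x - A =
      - delta ((1 - p) * x * (1 - q)).
    rewrite !(mulrBl, mulrBr, mul1r, mulr1, raddfB) /= -/A.
    by rewrite !opprK [- _ + _]addrC [RHS]addrACA [RHS]addrA.
  by rewrite mulrN mulNr oppr_eq0; apply/eqP; exact: ann.
have {1}-> : A = (1 - p) * A * (1 - q) + p * A * (1 - q) +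
    ((1 - p) * A * q + p * A * q).
  by rewrite -!mulrDl subrK mul1r -mulrDr subrK mulr1.
rewrite e1 e2 e3 e4 add0r mulrBr mulr1 !mulrBl mul1r.
set u := p * delta (x * q); set v := delta (p * x) * q.
rewrite -[p * _ * q]mulrA -/v -[p * v + _ - _]addrA [v - _ + _]addrA subrK.
by rewrite addrCA [_ - _ + _]addrA subrK addrA [u + v]addrC.
Qed.

Lemma sandwich_generated a b : idempotent_generated a ->
  idempotent_generated b -> sandwich_leibniz a b.
Proof.
move=> ga gb; elim: ga => {a}[p pp|a1 a2 _ IH1 _ IH2|a1 a2 _ IH1 _ IH2|k a1 _ IH].
- elim: gb => {b}[q qq|b1 b2 _ IH1 _ IH2|b1 b2 _ IH1 _ IH2|k b1 _ IH] x.
  + exact: sandwich_idempotent.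
  + rewrite !mulrDr !raddfD /= IH1 IH2 !mulrDr.
    by rewrite addrACA [X in X + _]addrACA.
  + have -> : p * x * (b1 * b2) = p * (x * b1) * b2 by rewrite !mulrA.
    rewrite IH2 [p * (x * b1)]mulrA IH1 !mulrA !mulrDl mulNr.
    by rewrite [_ + _ - _ * b2]addrAC [X in X - _]addrAC addrK addrAC.
  + by rewrite !nest_algebra_scaleAr !linearZ /= IH !nest_algebra_scaleAr !scalerDr.
- move=> x; rewrite !mulrDl !raddfD /= IH1 IH2 !mulrDl.
  by rewrite addrACA [X in X + _]addrACA.
- move=> x; have -> : a1 * a2 * x * b = a1 * (a2 * x) * b by rewrite !mulrA.
  rewrite IH1 -[a2 * x * b]mulrA mulrA -[a1 * delta (a2 * x) * b]mulrA.
  rewrite -addrA -mulrBr mulrA IH2 addrAC [_ * b + _]addrC addrK.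
  by rewrite mulrBr addrA !mulrA.
- move=> x; rewrite !nest_algebra_scaleAl !linearZ /= IH !nest_algebra_scaleAl.
  by rewrite !scalerDr linearN.
Qed.

(** Each of [a delta (x y) b], [a delta x (y b)] and [(a x) delta y b] is given
    by the rule for a product of three factors whose outer ones lie in [J]. The
    terms that do not cancel are those of the rule for [(a x) 1 (y b)], which
    vanish together because [delta 1 = 0]. *)
Lemma leibniz_defect_annihilated (J : Alg -> Prop) :
    (forall a x, J a -> J (a * x)) -> (forall a x, J a -> J (x * a)) ->
    (forall a, J a -> idempotent_generated a) -> delta 1 = 0 ->
  forall x y a b, J a -> J b ->
    a * (delta (x * y) - (delta x * y + x * delta y)) * b = 0.
Proof.
move=> Jr Jl Jg d1 x y a b Ja Jb.
have L c d : J c -> J d -> sandwich_leibniz c d.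
  by move=> /Jg gc /Jg gd; exact: sandwich_generated.
have E c u d : J c -> J d ->
    c * delta u * d = delta (c * u) * d + c * delta (u * d) - delta (c * u * d).
  by move=> Jc Jd; rewrite L// opprB [RHS]addrC subrK.
(* the rule with middle factor 1 *)
have e0 := E (a * x) 1 (y * b) (Jr _ _ Ja) (Jl b y Jb).
rewrite d1 mulr0 mul0r !mulr1 mul1r in e0.
have e1 := E (a * x) y b (Jr _ _ Ja) Jb.
have e2 := E a x (y * b) Ja (Jl b y Jb).
have e3 := E a (x * y) b Ja Jb.
rewrite mulrBr mulrBl mulrDr mulrDl !mulrA.
rewrite !mulrA in e0 e1 e2 e3; rewrite e1 e2 e3.
move: e0 => /esym/subr0_eq <-.
set s := delta (a * x) * y * b; set t := a * x * delta (y * b).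
set u := delta (a * x * y) * b; set v := a * delta (x * y * b).
rewrite [s + v]addrC addrKA {2}[s + t]addrC addrKA addrACA.
by rewrite -opprD [v + u]addrC [t + s]addrC subrr.
Qed.

End AnnihilatorPreserving.

Lemma local_derivation_annihilator : local_derivation delta ->
  forall a b c, a * b = 0 -> b * c = 0 -> a * delta b * c = 0.
Proof.
move=> locd a b c ab bc; have [d dP ->] := locd b.
have /eqP := dP a b; rewrite ab linear0 eq_sym addr_eq0 => /eqP /esym/eqP.
rewrite eqr_oppLR => /eqP ->.
by rewrite mulNr -mulrA bc mulr0 oppr0.
Qed.

Lemma local_derivation1 : local_derivation delta -> delta 1 = 0.
Proof.
move=> locd; have [d dP ->] := locd 1.
by have /eqP := dP 1 1; rewrite !mulr1 mul1r -subr_eq0 opprD addNKr oppr_eq0 => /eqP.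
Qed.

End LocalDerivations.

(** * Subspaces and bounded functionals *)

Section Subspaces.
Variables (K : numFieldType) (X : normedModType K).
Implicit Types (A N : set X) (x y : X) (k : K).

Lemma is_subspaceP A :
  is_subspace A <-> A 0 /\ forall k x y, A x -> A y -> A (k *: x + y).
Proof.
split=> [[A0 AD]|[A0 AD]]; split; first by rewrite inE in A0.
- by move=> k x y Ax Ay; have := AD k x y; rewrite !inE; exact.
- by rewrite inE.
- by move=> k x y; rewrite !inE; exact: AD.
Qed.

Lemma subspace0 A : is_subspace A -> A 0.
Proof. by move=> /is_subspaceP[]. Qed.

Lemma subspaceZ A k x : is_subspace A -> A x -> A (k *: x).
Proof. by move=> /is_subspaceP[A0 AD] Ax; rewrite -[_ *: _]addr0; exact: AD. Qed.

Lemma subspaceD A x y : is_subspace A -> A x -> A y -> A (x + y).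
Proof. by move=> /is_subspaceP[A0 AD] Ax; rewrite -[x]scale1r; exact: AD. Qed.

Lemma closed_span_sub A N : closed_subspace N -> A `<=` N -> closed_span A `<=` N.
Proof.
move=> [sN cN] AN; rewrite (closure_id N).1//.
by apply: closure_subset; exact: smallest_sub.
Qed.

Lemma sub_closed_span A : A `<=` closed_span A.
Proof. by apply: subset_trans (@subset_closure _ _); exact: sub_gen_smallest. Qed.

(** The bound may be any scalar, as for [bounded_operator]; over the complex
    numbers it is automatically real when the space is nonzero. *)
Definition bounded_functional (f : X -> K) :=
  scalar f /\ exists C : K, forall x, `|f x| <= C * `|x|.

Implicit Types f g : X -> K.

Lemma bounded_functionalD f g : bounded_functional f -> bounded_functional g ->
  bounded_functional (f \+ g).
Proof.
move=> [lf [C fC]] [lg [D gD]]; split.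
  by move=> k x y /=; rewrite lf lg mulrDr addrACA.
exists (C + D) => x; rewrite (le_trans (ler_normD _ _))// mulrDl.
by rewrite lerD.
Qed.

Lemma bounded_functionalZ k f : bounded_functional f ->
  bounded_functional (fun x => k * f x).
Proof.
move=> [lf [C fC]]; split.
  by move=> l x y /=; rewrite lf mulrDr mulrCA.
by exists (`|k| * C) => x; rewrite normrM -mulrA ler_wpM2l.
Qed.

Lemma functional0 f : scalar f -> f 0 = 0.
Proof. by move=> lf; have := lf (-1) 0 0; rewrite scaler0 !addr0 mulN1r addNr. Qed.

Lemma functionalD f x y : scalar f -> f (x + y) = f x + f y.
Proof. by move=> lf; have := lf 1 x y; rewrite scale1r mul1r. Qed.

Lemma functionalZ f k x : scalar f -> f (k *: x) = k * f x.
Proof. by move=> lf; have := lf k x 0; rewrite functional0// !addr0. Qed.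

Implicit Types T : X -> X.

Lemma bounded_operator_continuous T : bounded_operator T -> continuous T.
Proof.
move=> [lT [C TC]] x; apply/cvgrPdist_lt => e e0.
(* adding 1 makes the bound invertible *)
pose C' := `|C| + 1.
have C'0 : 0 < C' by rewrite ltr_wpDl.
have TB y z : T y - T z = T (y - z).
  by have := lT (-1) z y; rewrite !scaleN1r ![- _ + _]addrC => ->.
near=> y; rewrite TB (le_lt_trans (TC _))//.
have h : 0 <= C * `|x - y| by rewrite (le_trans _ (TC _)).
rewrite -(ger0_norm h) normrM normr_id.
apply: (@le_lt_trans _ _ (C' * `|x - y|)); first by rewrite ler_wpM2r// lerDl.
rewrite -ltr_pdivlMl//; near: y; apply: cvgr_dist_lt => //.
by rewrite mulr_gt0// invr_gt0.
Unshelve. all: by end_near. Qed.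

Lemma kernel_closed_subspace T : bounded_operator T ->
  closed_subspace [set x | T x = 0].
Proof.
move=> bT; have [lT _] := bT; split.
  apply/is_subspaceP; split=> /=.
    by have := lT (-1) 0 0; rewrite scaler0 !addr0 scaleN1r addNr.
  by move=> k x y Tx Ty; rewrite lT Tx Ty scaler0 addr0.
have -> : [set x | T x = 0] = T @^-1` [set 0] by [].
apply: closed_comp => [x _|]; last first.
  apply: accessible_closed_set1; apply: hausdorff_accessible.
  exact: norm_hausdorff.
exact: bounded_operator_continuous.
Qed.

End Subspaces.

(** * The Hahn-Banach theorem *)

Section HahnBanach.
Variables (R : realType) (V : lmodType R) (p : V -> R).
Hypothesis pD : forall x y, p (x + y) <= p x + p y.
Hypothesis pZ : forall k x, 0 <= k -> p (k *: x) = k * p x.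
Implicit Types (x y v : V) (G : set (V * R)) (r s c k : R).

(** A linear functional dominated by [p], defined on a subspace only, encoded
    as its graph so that extension is inclusion and Zorn's lemma applies to
    sets. Single-valuedness is a consequence of the domination, see
    [dominated_graph_fun]. *)
Definition dominated_graph G :=
  [/\ G (0, 0), forall k x y r s, G (x, r) -> G (y, s) -> G (k *: x + y, k * r + s)
    & forall x r, G (x, r) -> r <= p x].

Lemma dominated_graph_fun G x r s : dominated_graph G ->
  G (x, r) -> G (x, s) -> r = s.
Proof.
move=> [_ lG dG] Gr Gs.
have p0 : p 0 = 0 by rewrite -(scale0r 0) pZ// mul0r.
have le u w : G (x, u) -> G (x, w) -> u <= w.
  move=> Gu Gw; have := dG _ _ (lG (-1) _ _ _ _ Gw Gu).
  by rewrite scaleN1r addNr p0 mulN1r addrC subr_le0.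
by apply/eqP; rewrite eq_le !le.
Qed.

(** The value [c] at [v] has to satisfy [r - p (x - v) <= c <= p (y + v) - t]
    for all [(x, r)] and [(y, t)] in the graph. The left sides are below the
    right sides by subadditivity, so their supremum will do; the general
    element [x + k v] reduces to [k = 1] or [k = -1] by homogeneity. *)
Lemma dominated_graph_extend G v : dominated_graph G ->
  exists c, dominated_graph
    [set z | exists x r k, G (x, r) /\ z = (x + k *: v, r + k * c)].
Proof.
move=> [G0 lG dG].
pose S := [set s | exists x r, G (x, r) /\ s = r - p (x - v)].
have ubS y t : G (y, t) -> ubound S (p (y + v) - t).
  move=> Gy _ [x [r [Gx ->]]].
  rewrite lerBlDr addrAC lerBrDr.
  have : r + t <= p (x + y).
    by have := dG _ _ (lG 1 _ _ _ _ Gx Gy); rewrite scale1r mul1r.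
  move=> /le_trans; apply; rewrite [p (y + v) + _]addrC.
  by rewrite (le_trans _ (pD _ _))// addrACA [- v + v]addNr addr0.
have S0 : S !=set0 by exists (0 - p (0 - v)), 0, 0.
have hS : has_sup S by split=> //; exists (p (0 + v) - 0); exact: ubS.
pose c := sup S; exists c.
have lo x r : G (x, r) -> r - c <= p (x - v).
  move=> Gx; rewrite lerBlDr addrC -lerBlDr.
  by apply: ub_le_sup; [case: hS|exists x, r].
have up x r : G (x, r) -> r + c <= p (x + v).
  by move=> Gx; rewrite addrC -lerBrDr; apply: ge_sup => //; exact: ubS.
have G_Z k x r : G (x, r) -> G (k *: x, k * r).
  by move=> Gx; have := lG k _ _ _ _ Gx G0; rewrite !addr0.
split.
- by exists 0, 0, 0; split=> //; rewrite scale0r mul0r !addr0.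
- move=> k _ _ _ _ [x [r [l [Gx [-> ->]]]]] [y [s [m [Gy [-> ->]]]]].
  exists (k *: x + y), (k * r + s), (k * l + m); split; first exact: lG.
  rewrite scalerDr mulrDr scalerDl mulrDl scalerA mulrA.
  by rewrite addrACA [in X in (_, X)]addrACA.
- move=> _ _ [x [r [k [Gx [-> ->]]]]].
  have [k0|k0|->] := ltrgtP k 0; last first.
  + by rewrite scale0r mul0r !addr0; exact: dG.
  + have := up _ _ (G_Z k^-1 _ _ Gx).
    rewrite -(ler_pM2l k0) mulrDr mulVKf ?gt_eqF// -pZ; last exact: ltW.
    by rewrite scalerDr scalerA mulfV ?gt_eqF// scale1r.
  + have := lo _ _ (G_Z (- k)^-1 _ _ Gx).
    have k0' : 0 < - k by rewrite oppr_gt0.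
    rewrite -(ler_pM2l k0') mulrBr mulVKf ?gt_eqF// -pZ; last exact: ltW.
    rewrite scalerBr scalerA mulfV ?gt_eqF// scale1r.
    by rewrite mulNr scaleNr !opprK.
Qed.

Theorem hahn_banach G : dominated_graph G ->
  exists f : V -> R, [/\ scalar f, forall x, f x <= p x
    & forall x r, G (x, r) -> f x = r].
Proof.
move=> dG.
(* The empty set is admitted because it is the union of the empty chain. *)
pose P := [set H | H = set0 \/ (G `<=` H /\ dominated_graph H)].
have [F FP Ftot|H [PH Hmax]] := @Zorn_bigcup _ P.
  have [F0|] := pselect (exists2 H, F H & H !=set0); last first.
    move=> F0; left; apply/seteqP; split=> // z [H FH Hz].
    by apply: F0; exists H => //; exists z.
  have FG H z : F H -> H z -> G `<=` H /\ dominated_graph H.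
    by move=> FH Hz; have [H0|//] := FP _ FH; rewrite H0 in Hz.
  have [H FH [z Hz]] := F0; have [GH [H0 lH dH]] := FG _ _ FH Hz.
  right; split; first by move=> u Gu; exists H => //; exact: GH.
  split; first by exists H.
    move=> k x y r s [H1 F1 H1x] [H2 F2 H2y].
    have [_ [_ l1 _]] := FG _ _ F1 H1x; have [_ [_ l2 _]] := FG _ _ F2 H2y.
    have [H12|H21] := Ftot _ _ F1 F2.
      by exists H2 => //; apply: l2 => //; exact: H12.
    by exists H1 => //; apply: l1 => //; exact: H21.
  by move=> x r [H1 F1 H1x]; have [_ [_ _ d1]] := FG _ _ F1 H1x; exact: d1.
have {PH} [GH dH] : G `<=` H /\ dominated_graph H.
  case: PH => // H0; exfalso; apply: (Hmax G); last by right; split.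
  by rewrite H0; split=> // GH; have [G0 _ _] := dG; have := GH _ G0.
have tot x : exists r, H (x, r).
  have [c dc] := dominated_graph_extend x dH.
  set H' := [set z | _] in dc.
  have HH' : H `<=` H'.
    by move=> [y s] Hy; exists y, s, 0; split=> //; rewrite scale0r mul0r !addr0.
  have [H'H|nH] := pselect (H' `<=` H).
    exists c; apply: H'H; exists 0, 0, 1; have [H0 _ _] := dH.
    by split=> //; rewrite scale1r mul1r !add0r.
  by exfalso; apply: (Hmax H'); [split|right; split=> //; exact: subset_trans HH'].
have [f fH] := choice tot.
exists f; split.
- move=> k x y; apply: (dominated_graph_fun dH (fH _)).
  by have [_ lH _] := dH; apply: lH.
- by move=> x; have [_ _ dH'] := dH; exact: dH'.
- by move=> x r Gx; apply: (dominated_graph_fun dH (fH _)); exact: GH.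
Qed.

End HahnBanach.

Section RealSeparation.
Variables (R : realType) (X : normedModType R).

(** The constant is the distance of [x] to [M], or any smaller one: a ball
    around [x] avoiding [M] scales to a ball around [k x] avoiding [M]. *)
Lemma closed_subspace_distance (M : set X) x : closed_subspace M -> ~ M x ->
  exists2 e : R, 0 < e & forall m k, M m -> `|k| * e <= `|m + k *: x|.
Proof.
move=> [sM cM] Mx.
have : nbhs x (~` M) by apply: open_nbhs_nbhs; split=> //; exact: closed_openC.
move=> /nbhs_normP[e /= e0 eM]; exists e => // m k Mm.
have [->|k0] := eqVneq k 0; first by rewrite normr0 mul0r.
rewrite leNgt; apply/negP => h; apply: (eM (- k^-1 *: m)); last exact: subspaceZ.
rewrite /= scaleNr opprK.
rewrite -(ltr_pM2l (_ : 0 < `|k|)) ?normr_gt0// -normrZ scalerDr scalerA.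
by rewrite mulfV// scale1r addrC.
Qed.

(** On the span of [M] and [x] take the functional [m + r x |-> r]; its
    graph is the set [G] of the proof, and it is dominated by a multiple of the
    norm because [x] has positive distance to [M]. *)
Lemma real_separation (M : set X) x : closed_subspace M -> ~ M x ->
  exists f, [/\ bounded_functional f, forall y, M y -> f y = 0 & f x = 1].
Proof.
move=> cM Mx; have [e e0 eM] := closed_subspace_distance cM Mx.
have [sM _] := cM; have /is_subspaceP[M0 MD] := sM.
pose p (y : X) := e^-1 * `|y|.
pose G := [set z : X * R | exists m, M m /\ z.1 = m + z.2 *: x].
have pD y z : p (y + z) <= p y + p z.
  by rewrite /p -mulrDr ler_pM2l ?invr_gt0// ler_normD.
have pZ k y : 0 <= k -> p (k *: y) = k * p y.
  by move=> k0; rewrite /p normrZ ger0_norm// mulrCA.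
have dG : dominated_graph p G.
  split.
  - by exists 0; split=> //=; rewrite scale0r addr0.
  - move=> k y z r s [m [Mm /= ->]] [n [Mn /= ->]].
    exists (k *: m + n); split=> /=; first exact: MD.
    by rewrite scalerDr scalerDl scalerA addrACA.
  - move=> y r [m [Mm /= ->]].
    rewrite /p ler_pdivlMl// mulrC (le_trans _ (eM _ _ Mm))//.
    by rewrite ler_pM2r// ler_norm.
have [f [lf fp fG]] := hahn_banach pD pZ dG.
exists f; split.
- split=> //; exists e^-1 => y; rewrite ler_norml fp andbT.
  have fN : f (- y) = - f y by rewrite -scaleN1r functionalZ// mulN1r.
  by rewrite lerNl -fN (le_trans (fp _))// /p normrN.
- by move=> y My; apply: fG; exists y; split=> //=; rewrite scale0r addr0.
- by apply: fG; exists 0; split=> //=; rewrite scale1r add0r.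
Qed.

End RealSeparation.

(** * Projections along a closed complement *)

Section AlgebraicProjection.
Variables (K : numFieldType) (X : normedModType K).
Implicit Types (N M : set X).

Lemma complementary_unique N M x y z : is_subspace N -> is_subspace M ->
  N `&` M = [set 0] -> N y -> M (x - y) -> N z -> M (x - z) -> y = z.
Proof.
move=> sN sM NM Ny My Nz Mz; apply/eqP; rewrite -subr_eq0; apply/eqP.
suff : (N `&` M) (y - z) by rewrite NM.
split.
  by apply: subspaceD => //; rewrite -scaleN1r; exact: subspaceZ.
have -> : y - z = (-1) *: (x - y) + (x - z).
  by rewrite scaleN1r opprB addrA subrK.
by apply: subspaceD => //; exact: subspaceZ.
Qed.

Lemma complementary_projection N M : is_subspace N -> is_subspace M ->
  N `&` M = [set 0] -> (forall x, exists y z, [/\ N y, M z & x = y + z]) ->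
  exists P : {linear X -> X}, forall x, N (P x) /\ M (x - P x).
Proof.
move=> sN sM NM dec.
have /choice[P Pdec] : forall x, exists y, N y /\ M (x - y).
  by move=> x; have [y [z [Ny Mz ->]]] := dec x; exists y; rewrite addrC addKr.
have lP : linear P.
  move=> k x y; have [NPx MPx] := Pdec x; have [NPy MPy] := Pdec y.
  have [NP MP] := Pdec (k *: x + y).
  apply: (complementary_unique sN sM NM NP MP).
    by apply: subspaceD => //; exact: subspaceZ.
  rewrite opprD addrACA -scalerBr.
  by apply: subspaceD => //; exact: subspaceZ.
by exists (HB.pack_for {linear X -> X} P (GRing.isLinear.Build _ _ _ _ _ lP)).
Qed.

End AlgebraicProjection.

Section RealProjection.
Variables (R : realType) (X : completeNormedModType R) (N M : set X).
Hypotheses (cN : closed_subspace N) (cM : closed_subspace M).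
Hypothesis NM : N `&` M = [set 0].
Variable P : {linear X -> X}.
Hypothesis PNM : forall x, N (P x) /\ M (x - P x).

(** The sets where [P] is bounded by [n] cover the space, so by Baire's theorem
    the complements of their closures cannot all be dense. *)
Lemma some_sublevel_somewhere_dense : exists n x0, exists2 r : R, 0 < r &
  ball x0 r `<=` closure [set x | `|P x| <= n%:R].
Proof.
pose O n := ~` closure [set x | `|P x| <= n%:R].
have [n nO] : exists n, ~ dense (O n).
  apply: contrapT => /forallNP H.
  have dO : dense (\bigcap_n O n).
    apply: Baire => n; split; last by have := H n; apply: contrapT.
    by apply: closed_openC; exact: closed_closure.
  have /(_ _ openT)[|x [_ /(_ (Num.truncn `|P x|).+1 Logic.I)]] := dO setT.
    by exists 0.
  by apply; apply: subset_closure => /=; apply/ltW; rewrite truncnS_gt.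
have [A [[x oA] AO]] := denseNE nO.
have /nbhs_ballP[r r0 rA] := open_nbhs_nbhs oA.
exists n, x, r => // y /rA Ay; apply: contrapT => yO.
by have : (A `&` O n) y by []; rewrite AO.
Qed.

(** Differences of two elements of the sublevel set that is dense in the ball
    around [x0] approximate every small vector, and scaling gives all vectors:
    [x0] and [x0 + s y], with [s y] of norm [r / 2], are both approximated to
    within [r / 8], so [s y] is to within half of its norm. *)
Lemma approximate_with_small_projection : exists2 C : R, 0 <= C &
  forall y, exists u, `|y - u| <= `|y| / 2 /\ `|P u| <= C * `|y|.
Proof.
have [n [x0 [r r0 rA]]] := some_sublevel_somewhere_dense.
exists (4 * n%:R / r); first by rewrite divr_ge0 ?mulr_ge0 ?(ltW r0).
move=> y; have [->|y0] := eqVneq y 0.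
  by exists 0; rewrite subrr linear0 !normr0 mul0r mulr0.
have ny0 : 0 < `|y| by rewrite normr_gt0.
pose s := r / 2 / `|y|.
have s0 : 0 < s by rewrite !divr_gt0.
have approx x : ball x0 r x -> exists2 a, `|x - a| < r / 8 & `|P a| <= n%:R.
  move=> /rA /(_ (ball x (r / 8)) _)[|a [Pa xa]].
    by apply: nbhsx_ballx; rewrite divr_gt0.
  by exists a => //; move: xa; rewrite -ball_normE.
have [a xa Pa] := approx x0 (ballxx _ r0).
have [|b xb Pb] := approx (x0 + s *: y).
  rewrite -ball_normE /ball_ /= opprD addNKr normrN normrZ gtr0_norm//.
  by rewrite /s divfK ?gt_eqF// ltr_pdivrMr// ltr_pMr// ltr1n.
have sy : s * `|y| = r / 2 by rewrite /s divfK ?gt_eqF.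
have s1 : s^-1 *: (s *: y) = y by rewrite scalerA mulVf ?scale1r ?gt_eqF.
exists (s^-1 *: (b - a)); split.
  rewrite -{1}s1 -scalerBr normrZ gtr0_norm ?invr_gt0// ler_pdivrMl//.
  have -> : s *: y - (b - a) = (x0 + s *: y - b) - (x0 - a).
    by rewrite !opprB [a - x0]addrC addrACA [x0 + _]addrC addrK [- b + a]addrC.
  apply: le_trans (ler_normB _ _) _; rewrite mulrA sy.
  by lra.
rewrite linearZ linearB /= normrZ gtr0_norm ?invr_gt0// ler_pdivrMl//.
rewrite mulrCA sy (_ : _ * (r / 2) = n%:R + n%:R); last by field; rewrite gt_eqF.
by apply: le_trans (ler_normB _ _) _; exact: lerD.
Qed.

(** Subtracting approximations repeatedly leaves remainders [z k] of norm at
    most [|y| / 2 ^ k], and writes [y] as a series of terms [w k] whose images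
    under [P] are summable. The sum [a] of the images lies in [N] and [y - a]
    in [M], both being closed; hence [P y = a], and [a] is bounded by the
    geometric series. *)
Lemma real_projection_bounded : exists C, forall x, `|P x| <= C * `|x|.
Proof.
have [C C0 /choice[u uP]] := approximate_with_small_projection.
exists (2 * C) => y.
pose z k := iter k (fun v => v - u v) y.
have zB k : `|z k| <= `|y| / 2 ^+ k.
  elim: k => [|k IH]; first by rewrite expr0 divr1.
  rewrite /z iterS -/(z k); apply: le_trans (uP (z k)).1 _.
  by rewrite exprSr invfM mulrA ler_pM2r.
pose w k := u (z k).
have sumw n : series w n = y - z n.
  elim: n => [|n IH]; first by rewrite /series /= big_geq// subrr.
  by rewrite seriesS IH /z iterS -/(z n) opprB addrCA addrA.
have wB k : `|P (w k)| <= geometric (C * `|y|) 2^-1 k.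
  apply: le_trans (uP (z k)).2 _; rewrite /= -mulrA ler_wpM2l//.
  by rewrite exprVn; exact: zB.
have half : `|2^-1 : R| < 1 by rewrite gtr0_norm ?invr_gt0// invf_lt1// ltr1n.
have cgeo := is_cvg_geometric_series (a := C * `|y|) half.
have cn : cvgn [normed series (P \o w)].
  apply: (series_le_cvg _ _ _ cgeo) => k; [exact: normr_ge0| |exact: wB].
  exact: le_trans (normr_ge0 _) (wB k).
have cs := normed_cvg cn.
set a := limn (series (P \o w)) in cs.
have Psum n : P (series w n) = series (P \o w) n.
  by rewrite /series /= raddf_sum.
have zcv : z @ \oo --> 0.
  apply/norm_cvg0P; apply: (@squeeze_cvgr _ _ _ _ (cst 0) (geometric `|y| 2^-1)).
  - by apply: nearW => k; rewrite /= normr_ge0/= exprVn; exact: zB.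
  - exact: cvg_cst.
  - exact: cvg_geometric.
have Na : N a.
  apply: (closed_cvg (F := \oo) (u_ := series (P \o w))) cs; first by case: cN.
  by apply: nearW => n; rewrite -Psum; case: (PNM (series w n)).
have Ma : M (y - a).
  apply: (closed_cvg (F := \oo) (u_ := fun n => series w n - series (P \o w) n)).
  - by case: cM.
  - by apply: nearW => n; rewrite -Psum; case: (PNM (series w n)).
  - apply: cvgB cs; rewrite (_ : series w = fun n => y - z n); last exact/funext.
    by rewrite -[X in _ --> X]subr0; apply: cvgB => //; exact: cvg_cst.
have [Py Py'] := PNM y.
rewrite (complementary_unique _ _ NM Py Py' Na Ma); last 2 first.
- by case: cN.
- by case: cM.
apply: le_trans (lim_series_norm cn) _.
rewrite (_ : 2 * C * `|y| = limn (series (geometric (C * `|y|) 2^-1))).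
  exact: lim_series_le.
apply/esym/cvg_lim => //.
rewrite (_ : 2 * C * `|y| = C * `|y| / (1 - 2^-1)); last by field.
exact: cvg_geometric_series.
Qed.

End RealProjection.

(** * Restriction of scalars to the reals *)

(** An alias of the complex space, which carries the same uniform structure
    (so closed sets and completeness are shared by conversion) and receives a
    real vector space structure and a real valued norm. *)
Definition realification (R : realType)
  (X : completeNormedModType (complex R)) : Type := X.

Section Realification.
Variables (R : realType) (X : completeNormedModType (complex R)).
Local Notation XR := (realification X).

HB.instance Definition _ := GRing.Zmodule.copy XR X.
HB.instance Definition _ := Complete.copy XR X.

Definition rscale (k : R) (x : XR) : XR := real_complex R k *: (x : X).

Fact rscaleA a b x : rscale a (rscale b x) = rscale (a * b) x.
Proof. by rewrite /rscale scalerA rmorphM. Qed.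
Fact rscale1 : left_id 1 rscale.
Proof. by move=> x; rewrite /rscale rmorph1 scale1r. Qed.
Fact rscaleDr : right_distributive rscale +%R.
Proof. by move=> a x y; exact: scalerDr. Qed.
Fact rscaleDl x : {morph rscale^~ x : a b / a + b}.
Proof. by move=> a b; rewrite /rscale rmorphD scalerDl. Qed.

HB.instance Definition _ := GRing.Zmodule_isLmodule.Build R XR
  rscaleA rscale1 rscaleDr rscaleDl.

Definition rnorm (x : XR) : R := complex.Re `|x : X|.

Lemma rnormE x : real_complex R (rnorm x) = `|x : X|.
Proof. by apply: RRe_real; exact: normr_real. Qed.

Fact rnormD x y : rnorm (x + y) <= rnorm x + rnorm y.
Proof. by rewrite -lecR rmorphD /= !rnormE ler_normD. Qed.
Fact rnorm0_eq0 x : rnorm x = 0 -> x = 0.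
Proof. by move=> x0; apply: (@normr0_eq0 _ X); rewrite -rnormE x0. Qed.
Fact rnormMn x n : rnorm (x *+ n) = rnorm x *+ n.
Proof. by apply: complexI; rewrite rmorphMn /= !rnormE normrMn. Qed.
Fact rnormN x : rnorm (- x) = rnorm x.
Proof. by rewrite /rnorm normrN. Qed.

HB.instance Definition _ := Num.Zmodule_isNormed.Build R XR
  rnormD rnorm0_eq0 rnormMn rnormN.

Let rball : XR -> R -> XR -> Prop := ball_ (fun x : XR => `|x|).

Fact rball_center x (e : R) : 0 < e -> rball x e x.
Proof. exact: ball_norm_center. Qed.
Fact rball_sym x y (e : R) : rball x e y -> rball y e x.
Proof. exact: ball_norm_symmetric. Qed.
Fact rball_triangle x y z e1 e2 : rball x e1 y -> rball y e2 z ->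
  rball x (e1 + e2) z.
Proof. exact: ball_norm_triangle. Qed.
Fact rentourageE : entourage = entourage_ rball :> set_system (XR * XR).
Proof.
transitivity (@entourage X) => //; rewrite -entourage_ballE.
apply/seteqP; split=> A [e /= e0 eA].
- exists (complex.Re e) => /=; first by rewrite -ltcR RRe_real// gtr0_real.
  move=> [x y] /= xy; apply: eA; rewrite -ball_normE /ball_ /=.
  by rewrite -rnormE -[e]RRe_real ?gtr0_real// ltcR.
- exists (real_complex R e) => /=; first by rewrite ltcR.
  move=> [x y] /=; rewrite -ball_normE /ball_ /= => xy; apply: eA => /=.
  by move: xy; rewrite -rnormE ltcR.
Qed.

HB.instance Definition _ := Uniform_isPseudoMetric.Build R XR
  rball_center rball_sym rball_triangle rentourageE.
HB.instance Definition _ := NormedZmod_PseudoMetric_eq.Build R XR erefl.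

Fact rnormZ (k : R) (x : XR) : `|k *: x| = `|k| * `|x|.
Proof.
apply: complexI; rewrite rmorphM /= !rnormE normrZ; congr (_ * _).
by rewrite normc_def /= expr0n addr0 sqrtr_sqr.
Qed.

HB.instance Definition _ :=
  PseudoMetricNormedZmod_Lmodule_isNormedModule.Build R XR rnormZ.

Lemma realification_normE (x : XR) : real_complex R `|x| = `|x : X|.
Proof. exact: rnormE. Qed.

Lemma realification_closed_subspace (N : set X) :
  closed_subspace N -> closed_subspace (N : set XR).
Proof.
move=> [/is_subspaceP[N0 ND] cN]; split; last exact: cN.
by apply/is_subspaceP; split=> // k x y; exact: ND.
Qed.

End Realification.

Section ComplexTheorems.
Variables (R : realType) (X : completeNormedModType (complex R)).
Local Notation XR := (realification X).
Local Notation C := (complex R).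
Local Notation toC := (real_complex R).
Local Notation i := ('i%C : C).

(** The complex functional with real part [g]: it is complex linear since
    [f (i x) = i f x] for [f x = g x - i g (i x)]. *)
Lemma complexify_functional (g : XR -> R) : bounded_functional g ->
  bounded_functional (fun x : X => toC (g x) - i * toC (g (i *: x))).
Proof.
move=> [lg [B gB]].
have gD (x y : X) : g (x + y) = g x + g y by exact: (functionalD (X := XR)).
have gZ k (x : X) : g (toC k *: x) = k * g x.
  by exact: (functionalZ (X := XR) k x).
have ii : i * i = -1 by rewrite -expr2 sqr_i.
have ni : `|i| = 1 by rewrite normc_def /= expr0n add0r expr1n sqrtr1.
split; last first.
  exists (toC (B + B)) => x.
  apply: le_trans (ler_normB _ _) _; rewrite normrM ni mul1r.
  have h (y : X) : `|toC (g y)| <= toC B * `|y|.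
    have := gB y; rewrite -lecR rmorphM /= realification_normE; apply: le_trans.
    by rewrite normc_def /= expr0n addr0 sqrtr_sqr.
  rewrite rmorphD /= mulrDl lerD//.
  by have := h (i *: x); rewrite normrZ ni mul1r.
move=> k x y.
have -> : k = toC (complex.Re k) + i * toC (complex.Im k).
  exact: complexE.
move: (complex.Re k) (complex.Im k) => a b {k}.
rewrite scalerDr !gD scalerA.
have e1 : g ((toC a + i * toC b) *: x) = a * g x + b * g (i *: x).
  by rewrite scalerDl [i * _]mulrC -scalerA gD !gZ.
have e2 : g ((i * (toC a + i * toC b)) *: x) = a * g (i *: x) - b * g x.
  rewrite mulrDr mulrA ii mulN1r -rmorphN scalerDl gD gZ mulNr.
  by rewrite [i * _]mulrC -scalerA gZ.
rewrite e1 e2 !(rmorphD, rmorphM, rmorphN, rmorphB) /=.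
move: (toC a) (toC b) (toC (g x)) (toC (g (i *: x))) => *.
move: (toC (g y)) (toC (g (i *: y))) => *.
ring: ii.
Qed.

(** The functional [f] obtained from the real case vanishes on [M], which is
    stable under [i]; at [x] its real part is [1], so it can be normalized. *)
Lemma complex_separation (M : set X) x : closed_subspace M -> ~ M x ->
  exists f, [/\ bounded_functional f, forall y, M y -> f y = 0 & f x = 1].
Proof.
move=> cM Mx; have [sM _] := cM.
have [g [bg gM gx]] := real_separation (realification_closed_subspace cM) Mx.
have bf := complexify_functional bg.
set f := fun x : X => _ in bf.
have fx0 : f x != 0.
  apply/eqP => fx0; move: (congr1 (@complex.Re R) fx0).
  by rewrite /f gx /= !(mul0r, mulr0) subrr oppr0 addr0 => /eqP; rewrite oner_eq0.
exists (fun y => (f x)^-1 * f y); split; first exact: bounded_functionalZ.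
- move=> y My; have Miy : M (i *: y) by exact: subspaceZ.
  by rewrite /f (gM _ My) (gM _ Miy) (_ : toC 0 = 0)// mulr0 subr0 mulr0.
- by rewrite /= mulVf.
Qed.

Lemma complex_projection_bounded (N M : set X) (P : {linear X -> X}) :
  closed_subspace N -> closed_subspace M -> N `&` M = [set 0] ->
  (forall x, N (P x) /\ M (x - P x)) -> exists B, forall x, `|P x| <= B * `|x|.
Proof.
move=> cN cM NM PNM.
have lP : linear (P : XR -> XR) by move=> k x y; exact: linearP.
have [B PB] := real_projection_bounded (realification_closed_subspace cN)
  (realification_closed_subspace cM) NM
  (P := HB.pack_for {linear XR -> XR} (P : XR -> XR)
     (GRing.isLinear.Build _ _ _ _ _ lP))
  PNM.
exists (toC B) => x.
by have := PB x; rewrite -lecR rmorphM /= !realification_normE.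
Qed.

End ComplexTheorems.

(** * Separation and projections over real or complex scalars *)

Section Scalars.
Variables (K : numFieldType) (scalars : real_or_complex K).

Theorem separation (X : completeNormedModType K) (M : set X) x :
  closed_subspace M -> ~ M x ->
  exists f, [/\ bounded_functional f, forall y, M y -> f y = 0 & f x = 1].
Proof.
by case: scalars X M x => R X M x; [exact: real_separation|exact: complex_separation].
Qed.

Theorem projection_bounded (X : completeNormedModType K) (N M : set X)
    (P : {linear X -> X}) :
  closed_subspace N -> closed_subspace M -> N `&` M = [set 0] ->
  (forall x, N (P x) /\ M (x - P x)) -> exists B, forall x, `|P x| <= B * `|x|.
Proof.
case: scalars X N M P => R X N M P cN cM NM.
  exact: real_projection_bounded.
exact: complex_projection_bounded.
Qed.

Theorem complemented_projection (X : completeNormedModType K) (N : set X) :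
  closed_subspace N -> complemented N ->
  exists P, [/\ bounded_operator P, forall x, N (P x) & forall x, N x -> P x = x].
Proof.
move=> cN [M [cM NM dec]]; have [sN _] := cN; have [sM _] := cM.
have [P PNM] := complementary_projection sN sM NM dec.
exists P; split=> [|x|x Nx]; last 2 first.
- by case: (PNM x).
- have [NP MP] := PNM x.
  apply: (complementary_unique sN sM NM NP MP Nx).
  by rewrite subrr; exact: subspace0.
split; first exact: linearP.
exact: projection_bounded cN cM NM PNM.
Qed.

End Scalars.

(** * Dyads in a nest algebra *)

Section Nests.
Variables (K : numFieldType) (X : normedModType K) (Nst : nest X).
Implicit Types (M N : set X) (x y : X).

Lemma nest_closed N : nest_set Nst N -> closed_subspace N.
Proof. by have [h _ _ _ _] := nestP Nst; exact: h. Qed.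

Lemma nest0 : nest_set Nst [set 0].
Proof. by have [_ _ [n0 nT] _ _] := nestP Nst; exact: n0. Qed.

Lemma nestT : nest_set Nst setT.
Proof. by have [_ _ [n0 nT] _ _] := nestP Nst; exact: nT. Qed.

Lemma nest_total M N : nest_set Nst M -> nest_set Nst N -> M `<=` N \/ N `<=` M.
Proof. by have [_ h _ _ _] := nestP Nst; exact: h. Qed.

Lemma nest_properVsub M N : nest_set Nst M -> nest_set Nst N ->
  M `<` N \/ N `<=` M.
Proof.
move=> NM NN; have [MN|] := nest_total NM NN; last by right.
by have [NM'|] := pselect (N `<=` M); [right|left; split].
Qed.

Lemma nest_pred_sub N : nest_set Nst N -> nest_pred Nst N `<=` N.
Proof.
move=> NN; apply: closed_span_sub; first exact: nest_closed.
by move=> x [M [_ [+ _]]]; exact.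
Qed.

Lemma sub_nest_pred M N : nest_set Nst M -> M `<` N -> M `<=` nest_pred Nst N.
Proof. by move=> NM MN x Mx; apply: sub_closed_span; exists M. Qed.

Lemma nest_pred_nest N : nest_set Nst (nest_pred Nst N).
Proof. by have [_ _ _ _ h] := nestP Nst; apply: h => M []. Qed.

End Nests.

Section Dyads.
Context {K : numFieldType} {X : normedModType K} {Nst : nest X}.
Local Notation Alg := (nest_algebra Nst).
Implicit Types (a b : Alg) (x y z : X) (f g : X -> K) (N : set X).

(** The condition on [x] and [f], witnessed by [N], under which
    [y |-> f y *: x] leaves the nest invariant: a member [M] either contains
    [N], hence [x], or is properly contained in [N] and so lies in [N_-],
    where [f] vanishes. Both [x] and [f] may be zero. *)
Definition admissible_dyad x f N :=
  [/\ nest_set Nst N, N x, bounded_functional f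
    & forall y, nest_pred Nst N y -> f y = 0].

Lemma admissible_dyad_operator x f N : admissible_dyad x f N ->
  (fun y => f y *: x) \in nest_operator Nst.
Proof.
move=> [NN Nx [lf [C fC]] fN]; apply/nest_operatorP; split.
  split; first by move=> k y z; rewrite lf scalerDl scalerA.
  exists (C * `|x|) => y; rewrite normrZ mulrAC.
  by rewrite ler_wpM2r.
move=> M NM y My; have [sM _] := nest_closed NM.
have [MN|NM'] := nest_properVsub NM NN.
  by rewrite fN ?scale0r; [exact: subspace0|exact: (sub_nest_pred NM)].
by apply: subspaceZ => //; exact: NM'.
Qed.

Definition dyad x f N (h : admissible_dyad x f N) : Alg :=
  NestAlgebra (admissible_dyad_operator h).

Definition is_dyad a := exists x f N,
  admissible_dyad x f N /\ forall y, a y = f y *: x.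

Lemma is_dyadMr a b : is_dyad a -> is_dyad (a * b).
Proof.
move=> [x [f [N [[NN Nx [lf [C fC]] fN] aE]]]].
have /nest_operatorP[[lb [D bD]] bN] := valP b.
exists x, (f \o b), N; split; last by move=> y; exact: aE.
split => //; last first.
  by move=> y Ny; apply: fN; apply: (bN _ (nest_pred_nest Nst N)).
split; first by move=> k y z /=; rewrite lb lf.
exists (`|C| * D) => y /=; apply: (le_trans (fC _)).
have h : 0 <= C * `|b y| by rewrite (le_trans _ (fC _)).
rewrite -(ger0_norm h) normrM normr_id -mulrA.
by apply: ler_wpM2l => //; exact: bD.
Qed.

Lemma is_dyadMl a b : is_dyad a -> is_dyad (b * a).
Proof.
move=> [x [f [N [[NN Nx [lf [C fC]] fN] aE]]]].
have /nest_operatorP[[lb [D bD]] bN] := valP b.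
exists (b x), f, N; split; first by split=> //; [exact: (bN N NN)|split=> //; exists C].
by move=> y; rewrite nest_algebra_mulE aE [LHS](linearZ_LR b).
Qed.

End Dyads.
Arguments admissible_dyad {K X} Nst x f N.

Section DyadsGenerated.
Context {K : numFieldType} {X : normedModType K} {Nst : nest X}.
Local Notation Alg := (nest_algebra Nst).
Implicit Types (a : Alg) (x y z : X) (f : X -> K) (N : set X).

Lemma dyad_idempotent a x f N : admissible_dyad Nst x f N ->
  (forall y, a y = f y *: x) -> f x = 1 -> a * a = a.
Proof.
move=> [_ _ [lf _] _] aE fx1; apply: val_inj; apply/funext => y.
rewrite -[LHS]/(a (a y)) -[RHS]/(a y) !aE.
have := lf (f y) x 0; have := lf (-1) 0 0.
rewrite scaler0 !addr0 mulN1r addNr => -> /=.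
by rewrite !addr0 fx1 mulr1 => ->.
Qed.

(** With [w] in [N] normalized to [f w = 1], the vector
    [x' = x + (1 - f x) w] also has [f x' = 1], and the dyad of [x] is the one
    of [x'] minus [1 - f x] times the one of [w], both idempotent. *)
Lemma dyad_generated_nonvanishing a x f N z : admissible_dyad Nst x f N ->
  (forall y, a y = f y *: x) -> N z -> f z != 0 -> idempotent_generated a.
Proof.
move=> [NN Nx bf fN] aE Nz0 fz0.
have [sN _] := nest_closed NN; have [lf _] := bf.
pose w := (f z)^-1 *: z.
have Nw : N w by exact: subspaceZ.
have fw1 : f w = 1 by rewrite /w functionalZ// mulVf.
have h1 : admissible_dyad Nst (x + (1 - f x) *: w) f N.
  by split=> //; apply: subspaceD => //; exact: subspaceZ.
have h2 : admissible_dyad Nst w f N by split.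
have -> : a = dyad h1 - (1 - f x) *: dyad h2.
  apply: val_inj; apply/funext => y.
  rewrite -[RHS]/(f y *: (x + (1 - f x) *: w) - (1 - f x) *: (f y *: w)) -[LHS]/(a y).
  by rewrite aE scalerDr !scalerA [(1 - _) * _]mulrC addrK.
apply: idempotent_generatedB; [|apply: IdemGenScale]; apply: IdemGenBase.
  apply: (dyad_idempotent h1) => //.
  by rewrite functionalD// functionalZ// fw1 mulr1 addrC subrK.
exact: (dyad_idempotent h2).
Qed.

End DyadsGenerated.

Section DyadsOverScalars.
Context {K : numFieldType} (scalars : real_or_complex K).
Context {X : completeNormedModType K} {Nst : nest X}.
Local Notation Alg := (nest_algebra Nst).
Implicit Types (a b t : Alg) (x y z : X) (f g : X -> K) (N M : set X).

(** Choose [z] in [N] outside [N_-] and [g] vanishing on [N_-] with [g z = 1].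
    The dyad of [(x, f)] is the product of those of [(x, g)] and [(z, f)]; the
    first is covered by [dyad_generated_nonvanishing], the second is the
    difference of the idempotent dyads of [(z, f + g)] and [(z, g)]. *)
Lemma dyad_generated_gap a x f N : admissible_dyad Nst x f N ->
  (forall y, a y = f y *: x) -> (forall y, N y -> f y = 0) ->
  ~ (N `<=` nest_pred Nst N) -> idempotent_generated a.
Proof.
move=> [NN Nx bf fN] aE f0 /nonsubset [z [Nz Nz']].
have [g [bg gN gz]] := separation scalars (nest_closed (nest_pred_nest Nst N)) Nz'.
have h1 : admissible_dyad Nst x g N by [].
have h2 : admissible_dyad Nst z (f \+ g) N.
  split=> //; first exact: bounded_functionalD.
  by move=> y Ny /=; rewrite fN// gN// addr0.
have h3 : admissible_dyad Nst z g N by [].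
have -> : a = dyad h1 * (dyad h2 - dyad h3).
  apply: val_inj; apply/funext => y.
  rewrite -[RHS]/(g ((f y + g y) *: z - g y *: z) *: x) -[LHS]/(a y) aE.
  by rewrite -scalerBl addrK functionalZ ?gz ?mulr1//; case: bg.
apply: IdemGenMul.
  apply: (dyad_generated_nonvanishing h1 _ Nz) => //.
  by rewrite gz oner_neq0.
by apply: idempotent_generatedB; apply: IdemGenBase;
  [apply: (dyad_idempotent h2)|apply: (dyad_idempotent h3)] => //=;
  rewrite f0// add0r.
Qed.

(** The projection [P] onto [N] leaves every member of the nest invariant:
    those inside [N] are fixed, those containing [N] contain the range. Since
    [P a = a] and [a P = 0] while [a a = 0], [P + a] is idempotent, and
    [a = (P + a) - P]. *)
Lemma dyad_generated_limit a x f N : admissible_dyad Nst x f N ->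
  (forall y, a y = f y *: x) -> (forall y, N y -> f y = 0) ->
  complemented N -> idempotent_generated a.
Proof.
move=> [NN Nx bf fN] aE f0 cN; have cl := nest_closed NN.
have [sN _] := cl.
have [P [bP PN PE]] := complemented_projection scalars cl cN.
have Pop : P \in nest_operator Nst.
  apply/nest_operatorP; split=> // M NM y My.
  have [MN|NM'] := nest_total NM NN; first by rewrite PE//; exact: MN.
  by apply: NM'; exact: PN.
pose p : Alg := NestAlgebra Pop.
have pE y : p y = P y by [].
have -> : a = (p + a) - p by rewrite addrC addKr.
apply: idempotent_generatedB; apply: IdemGenBase; apply: val_inj; apply/funext => y.
  rewrite -[LHS]/(p (p y + a y) + a (p y + a y)) -[RHS]/(p y + a y) !pE.
  have Npa : N (P y + a y).
    by apply: subspaceD => //; rewrite aE; exact: subspaceZ.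
  by rewrite PE// [a (P y + _)]aE f0// scale0r addr0.
by rewrite -[LHS]/(P (P y)) PE.
Qed.

Lemma dyad_generated a :
    (forall N, nest_set Nst N -> nest_pred Nst N = N -> complemented N) ->
  is_dyad a -> idempotent_generated a.
Proof.
move=> complN [x [f [N [h aE]]]]; have [NN _ _ _] := h.
have [f0|] := pselect (forall y, N y -> f y = 0); last first.
  move=> /existsNP [z /not_implyP [Nz /eqP fz]].
  exact: (dyad_generated_nonvanishing h aE Nz).
have [sub|] := pselect (N `<=` nest_pred Nst N).
  apply: (dyad_generated_limit h aE f0); apply: complN => //.
  by apply/seteqP; split=> //; exact: nest_pred_sub.
exact: (dyad_generated_gap h aE f0).
Qed.

(** * Dyads form a faithful ideal *)

(** Let [Z] be the intersection of the nonzero members of the nest. If [y] were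
    in [M_-] for each nonzero [M], it would be in [Z]. So [Z] would be nonzero,
    hence the least nonzero member, with [Z_-] zero; but [y] is in [Z_-]. *)
Lemma nest_separates_point y : y != 0 -> exists M x f,
  admissible_dyad Nst x f M /\ x != 0 /\ f y != 0.
Proof.
move=> y0; pose F := [set M | nest_set Nst M /\ M != [set 0]].
have FN : F `<=` nest_set Nst by move=> M [].
have nestI : nest_set Nst (\bigcap_(M in F) M).
  by have [_ _ _ h _] := nestP Nst; exact: h.
have [M [[NM M0] My]] : exists M, F M /\ ~ nest_pred Nst M y.
  apply: contrapT => H.
  have {}H M : F M -> nest_pred Nst M y.
    by move=> FM; apply: contrapT => My; apply: H; exists M.
  have Zy : (\bigcap_(M in F) M) y.
    by move=> M FM; apply: nest_pred_sub; [case: FM|exact: H].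
  set Z := \bigcap_(M in F) M in nestI Zy.
  have FZ : F Z.
    split=> //; apply/eqP => Z0.
    by move: Zy y0; rewrite Z0 => /= ->; rewrite eqxx.
  have : nest_pred Nst Z `<=` [set 0].
    apply: closed_span_sub; first exact: nest_closed (nest0 Nst).
    move=> x [M [NM [MZ ZM]] Mx]; apply: contrapT => x0; apply: ZM.
    apply: bigcap_inf; split=> //; apply/eqP => M0.
    by apply: x0; rewrite M0 in Mx.
  by move=> /(_ y (H _ FZ)) /eqP; exact/negP.
have [f [bf fM fy]] := separation scalars (nest_closed (nest_pred_nest Nst M)) My.
have [x [Mx x0]] : exists x, M x /\ x != 0.
  apply: contrapT => H; move/eqP: M0; apply; apply/seteqP; split=> x /=.
    by move=> Mx; apply: contrapT => /eqP x0; apply: H; exists x.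
  by move=> ->; apply: subspace0; case: (nest_closed NM).
by exists M, x, f; split=> //; split=> //; rewrite fy oner_neq0.
Qed.

(** An operator vanishing on each [N] with [N_-] proper vanishes everywhere:
    either the whole space is such an [N], or it is the closed span of its
    proper members, each of which is such an [N]. *)
Lemma nest_detects_operator a : a != 0 -> exists N z g w,
  admissible_dyad Nst z g N /\ a z != 0 /\ g w != 0.
Proof.
move=> a0; have /nest_operatorP[bT _] := valP a.
have [N [NN [NT [z [Nz az]]]]] : exists N, nest_set Nst N /\
    nest_pred Nst N != setT /\ exists z, N z /\ a z != 0.
  apply: contrapT => H.
  have {}H N : nest_set Nst N -> nest_pred Nst N != setT ->
      N `<=` [set x | a x = 0].
    move=> NN NT z Nz; apply: contrapT => /eqP az; apply: H.
    by exists N; split=> //; split=> //; exists z.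
  have aT : setT `<=` [set x | a x = 0].
    have [XT|XT] := eqVneq (nest_pred Nst setT) setT.
    2: by apply: H => //; exact: nestT.
    rewrite -{1}XT; apply: closed_span_sub; first exact: kernel_closed_subspace.
    move=> x [M [NM MT] Mx]; apply: (H M) => //.
    apply/eqP => MT'; have := nest_pred_sub NM.
    by rewrite MT'; case: MT.
  by move/eqP: a0; apply; apply: val_inj; apply/funext => x; exact: aT.
have [w Nw] : exists w, ~ nest_pred Nst N w.
  apply: contrapT => H; move/eqP: NT; apply; apply/seteqP; split=> // w _.
  by apply: contrapT => Nw; apply: H; exists w.
have [g [bg gN gw]] := separation scalars (nest_closed (nest_pred_nest Nst N)) Nw.
by exists N, z, g, w; split=> //; split=> //; rewrite gw oner_neq0.
Qed.

Lemma dyads_faithful t :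
  (forall a b, is_dyad a -> is_dyad b -> a * t * b = 0) -> t = 0.
Proof.
move=> H; apply/eqP; apply: contrapT => /negP t0.
have [N [z [g [w [h1 [tz gw]]]]]] := nest_detects_operator t0.
have [M [x [f [h2 [x0 ftz]]]]] := nest_separates_point tz.
have E : (dyad h2 * t * dyad h1) w = 0.
  by rewrite H//; [exists x, f, M|exists z, g, N].
move: E; rewrite -[LHS]/(f (t (g w *: z)) *: x) linearZ_LR.
rewrite functionalZ; last by case: h2 => _ _ [].
by move=> /eqP; rewrite !(scaler_eq0, mulf_eq0) (negPf gw) (negPf ftz) (negPf x0).
Qed.

End DyadsOverScalars.

Theorem corollary3p7 (K : numFieldType) (scalars : real_or_complex K)
    (X : completeNormedModType K) (dimX : dim_ge X 2) (Nst : nest X)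
    (complN : forall N : set X,
        nest_set Nst N -> nest_pred Nst N = N -> complemented N)
    (delta : {linear nest_algebra Nst -> nest_algebra Nst}) :
  local_derivation delta <-> derivation delta.
Proof.
split=> [locd x y|derd a]; last by exists delta.
apply/eqP; rewrite -subr_eq0; apply/eqP.
apply: (dyads_faithful scalars) => a b.
apply: (leibniz_defect_annihilated (local_derivation_annihilator locd)).
- by move=> *; exact: is_dyadMr.
- by move=> *; exact: is_dyadMl.
- by move=> c; exact: dyad_generated.
- exact: local_derivation1.
Qed.
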